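(* Let $e\in\mathbf N$ and let $I$ be a non-empty subset of $\{0,1,\dots,e\}$. There exists a prime differential ideal $\mathcal P\subset\mathcal F\{x_1,x_2\}$ of differential dimension $0$ such that $\operatorname{orders}\mathcal P=\{(a,e-a)\mid a\in I\}$.
   Context: $\mathcal F$ is an ordinary differential field of characteristic $0$. For a prime differential ideal $\mathcal P\subset\mathcal F\{x_1,\dots,x_n\}$ of differential dimension $0$ and a characteristic set $\mathcal A=\{A_1,\dots,A_n\}$ of $\mathcal P$ (in the sense of Ritt, for some ordering (ranking) on derivatives), numbered so that the main derivative of $A_j$ is a derivative of $x_j$, put $\operatorname{orders}\mathcal A=(\mathrm{ord}_{x_1}A_1,\dots,\mathrm{ord}_{x_n}A_n)$. Then $\operatorname{orders}\mathcal P=\{\operatorname{orders}\mathcal A\mid\mathcal A\text{ a characteristic set of }\mathcal P\text{ for some ordering}\}$. *)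

(* Defs.v *)
From HB Require Import structures.
From mathcomp Require Import all_boot all_order all_algebra.
From mathcomp Require Import finmap.
From mathcomp.multinomials Require Import monalg.

Set Implicit Arguments.
Unset Strict Implicit.
Unset Printing Implicit Defensive.

Import GRing.Theory.
Local Open Scope ring_scope.

Definition derivation (R : nzRingType) (d : R -> R) : Prop :=
  (forall a b, d (a + b) = d a + d b) /\
  (forall a b, d (a * b) = d a * b + a * d b).

(* The derivative x_i^(k) is the pair (i, k); indices start at 0. *)
Notation deriv n := ('I_n * nat)%type.

Definition dnext n (v : deriv n) : deriv n := (v.1, v.2.+1).

(* F{x_1, ..., x_n}, the polynomials over F in all the derivatives. *)
Notation dpoly F n := {malg F[{cmonom (deriv n)}]}.

(* The derivation of F{x_1, ..., x_n} that extends d and sends x_i^(k) to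
   x_i^(k+1): on a term, (c m)' = c' m + \sum_v c m(v) (m / v) v', where m(v) is
   the exponent of v in m. *)
Definition dpderiv (F : fieldType) (d : F -> F) n (A : dpoly F n) : dpoly F n :=
  \sum_(m <- msupp A)
    (<< d A@_m *g m >> +
     \sum_(v <- finsupp m)
        << A@_m *+ m v *g mmul (divcm m (ucm v)) (ucm (dnext v)) >>).

Section DpderivTheory.
Variables (F : fieldType) (d : F -> F).
Hypothesis dD : derivation d.
Variable n : nat.
Implicit Types (A B : dpoly F n) (m k : {cmonom (deriv n)}).

Let tm (c : F) m : dpoly F n :=
  << d c *g m >> + \sum_(v <- finsupp m)
        << c *+ m v *g mmul (divcm m (ucm v)) (ucm (dnext v)) >>.

Let d0 : d 0 = 0.
Proof. by apply: (addrI (d 0)); rewrite -dD.1 !addr0. Qed.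

Let d1 : d 1 = 0.
Proof.
by apply: (addrI (d 1)); rewrite addr0 -{3}[1 : F]mulr1 dD.2 mulr1 mul1r.
Qed.

Let tmEw (D : {fset (deriv n)}) c m : (finsupp m `<=` D)%fset ->
  tm c m = << d c *g m >> + \sum_(v <- D)
        << c *+ m v *g mmul (divcm m (ucm v)) (ucm (dnext v)) >>.
Proof.
move=> sD; congr (_ + _); apply: big_fset_incl => // v _.
by rewrite -cmE_eq0 => /eqP ->; rewrite mulr0n monalgU0.
Qed.

Let tm0 m : tm 0 m = 0.
Proof.
rewrite /tm d0 monalgU0 add0r big1 // => v _; by rewrite mul0rn monalgU0.
Qed.

Let tmD a b m : tm (a + b) m = tm a m + tm b m.
Proof.
rewrite /tm dD.1 monalgUD addrACA -big_split /=; congr (_ + _).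
by apply: eq_bigr => v _; rewrite mulrnDl monalgUD.
Qed.

Let dpderivEw (D : {fset {cmonom (deriv n)}}) A : (msupp A `<=` D)%fset ->
  dpderiv d A = \sum_(m <- D) tm A@_m m.
Proof.
move=> sD; apply: big_fset_incl => // m _.
by rewrite -mcoeff_eq0 => /eqP ->; rewrite -[RHS](tm0 m).
Qed.

Let dpderivD A B : dpderiv d (A + B) = dpderiv d A + dpderiv d B.
Proof.
rewrite (dpderivEw (msuppD_le A B)).
rewrite (dpderivEw (fsubsetUl (msupp A) (msupp B))).
rewrite (dpderivEw (fsubsetUr (msupp A) (msupp B))) -big_split /=.
by apply: eq_bigr => m _; rewrite mcoeffD tmD.
Qed.

Let dpderivU c m : dpderiv d << c *g m >> = tm c m.
Proof. by rewrite (dpderivEw msuppU_le) big_seq_fset1 mcoeffUU. Qed.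

Let dpderiv_sum (I : Type) (r : seq I) (f : I -> dpoly F n) :
  dpderiv d (\sum_(i <- r) f i) = \sum_(i <- r) dpderiv d (f i).
Proof.
elim: r => [|i r IH]; last by rewrite !big_cons dpderivD IH.
by rewrite !big_nil /dpderiv msupp0 big_nil.
Qed.

Let mulUU (a b : F) m k :
  << a *g m >> * << b *g k >> = << a * b *g mmul m k >> :> dpoly F n.
Proof. exact: fgmulUU. Qed.

Let mulE (D : seq (deriv n)) (f g : deriv n -> dpoly F n) p r q t :
  (p + \sum_(v <- D) f v) * r + q * (t + \sum_(v <- D) g v) =
  (p * r + q * t) + \sum_(v <- D) (f v * r + q * g v).
Proof.
by rewrite mulrDl mulrDr [LHS]addrACA mulr_suml mulr_sumr -big_split.
Qed.

Let divM m k v : m v != 0%N -> divcm (mmul m k) (ucm v) = mmul (divcm m (ucm v)) k.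
Proof.
move=> mv; apply/eqP/cmP => w; rewrite divcmE !cmM divcmE ucmE.
case: (eqVneq v w) => [<-|_]; last by rewrite !subn0.
by rewrite addnC -addnBA ?lt0n // addnC.
Qed.

Let tmM a b m k : tm (a * b) (mmul m k) =
  tm a m * << b *g k >> + << a *g m >> * tm b k.
Proof.
rewrite (tmEw _ (D := finsupp m `|` finsupp k)%fset); last by rewrite mdomD.
rewrite (tmEw a (fsubsetUl (finsupp m) (finsupp k))).
rewrite (tmEw b (fsubsetUr (finsupp m) (finsupp k))).
rewrite [RHS](mulE _ (fun v => << a *+ m v *g
    mmul (divcm m (ucm v)) (ucm (dnext v)) >>) (fun v => << b *+ k v *g
    mmul (divcm k (ucm v)) (ucm (dnext v)) >>)).
congr (_ + _).
  by rewrite dD.2 monalgUD; congr (_ + _); symmetry; exact: mulUU.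
apply: eq_bigr => v _.
rewrite cmM mulrnDr monalgUD; congr (_ + _); apply: etrans (esym (mulUU _ _ _ _)).
  case: (eqVneq (m v) 0%N) => [->|mv]; first by rewrite !mulr0n mul0r !monalgU0.
  rewrite (divM k mv) (mulrnAl a b).
  by apply: (congr1 (fun z => mkmalgU z _)); rewrite -!mulmA (mulmC k).
case: (eqVneq (k v) 0%N) => [->|kv]; first by rewrite !mulr0n mulr0 !monalgU0.
rewrite (mulmC m k) (divM m kv) (mulrnAr a b).
by apply: (congr1 (fun z => mkmalgU z _)); rewrite (mulmC _ m) -mulmA.
Qed.

Let dp_ind (K : dpoly F n -> Prop) :
  (forall c m, K << c *g m >>) -> (forall A B, K A -> K B -> K (A + B)) ->
  forall A, K A.
Proof.
move=> KU KD A; rewrite (monalgE A).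
apply: (big_ind K) => [|//|m _]; last exact: KU.
by have := KU 0 (onecm _); rewrite monalgU0.
Qed.

Let leibnizDl (R : nzRingType) (D : R -> R) (a b c : R) :
  D (a + b) = D a + D b -> D (a * c + b * c) = D (a * c) + D (b * c) ->
  D (a * c) = D a * c + a * D c -> D (b * c) = D b * c + b * D c ->
  D ((a + b) * c) = D (a + b) * c + (a + b) * D c.
Proof. by move=> e1 e2 e3 e4; rewrite mulrDl e2 e1 e3 e4 !mulrDl addrACA. Qed.

Let leibnizDr (R : nzRingType) (D : R -> R) (a b c : R) :
  D (a + b) = D a + D b -> D (c * a + c * b) = D (c * a) + D (c * b) ->
  D (c * a) = D c * a + c * D a -> D (c * b) = D c * b + c * D b ->
  D (c * (a + b)) = D c * (a + b) + c * D (a + b).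
Proof. by move=> e1 e2 e3 e4; rewrite mulrDr e2 e1 e3 e4 !mulrDr addrACA. Qed.

Fact dpderiv_derivation : derivation (@dpderiv F d n).
Proof.
split=> [|A B]; first exact: dpderivD.
elim/dp_ind: A => [a m|A1 A2 IH1 IH2]; last exact: leibnizDl.
elim/dp_ind: B => [b k|B1 B2 IH1 IH2]; last exact: leibnizDr.
apply: etrans (congr1 _ (mulUU a b m k)) _.
apply: etrans (dpderivU _ _) _.
apply: etrans (tmM a b m k) _.
exact: (congr2 +%R (congr1 ( *%R^~ << b *g k >>) (esym (dpderivU a m)))
                   (congr1 ( *%R << a *g m >>) (esym (dpderivU b k)))).
Qed.

Fact dpderivC c : dpderiv d (malgC c : dpoly F n) = malgC (d c).
Proof. by rewrite dpderivU /tm mdom1 big_seq_fset0 addr0. Qed.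

Fact dpderivX (v : deriv n) :
  dpderiv d (<< ucm v >> : dpoly F n) = << ucm (dnext v) >>.
Proof.
rewrite dpderivU /tm d1 monalgU0 add0r mdomU big_seq_fset1 cmUU mulr1n.
by congr << _ >>; apply/eqP/cmP => w; rewrite cmM divcmE subnn.
Qed.

End DpderivTheory.

Definition prime_diff_ideal (F : fieldType) (d : F -> F) n
    (P : dpoly F n -> Prop) : Prop :=
  [/\ P 0 /\ (forall A B, P A -> P B -> P (A + B)),
      forall A B, P B -> P (A * B),
      forall A, P A -> P (dpderiv d A),
      ~ P 1
    & forall A B, P (A * B) -> P A \/ P B].

Section CharacteristicSets.
Variables (F : fieldType) (n : nat).
Implicit Types (A B : dpoly F n) (v w : deriv n) (P : dpoly F n -> Prop).

Definition degv v A : nat := \max_(m <- msupp A) m v.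

Definition occurs v A : bool := (0 < degv v A)%N.

(* ord_{x_j} A; it is 0 when no derivative of x_j occurs in A, but it is only
   used when one does. *)
Definition ordv (j : 'I_n) A : nat :=
  \max_(m <- msupp A) \max_(v <- finsupp m | v.1 == j) v.2.

(* The differential dimension in the sense of Ritt: the largest number of
   unknowns that are differentially independent modulo P. *)
Definition diff_indep P (S : {set 'I_n}) : Prop :=
  forall A, P A -> (forall v, occurs v A -> v.1 \in S) -> A = 0.

Definition has_diff_dim P (q : nat) : Prop :=
  (exists S : {set 'I_n}, diff_indep P S /\ #|S| = q) /\
  (forall S : {set 'I_n}, diff_indep P S -> (#|S| <= q)%N).

Definition ranking (le : rel (deriv n)) : Prop :=
  [/\ total le, transitive le, antisymmetric le,
      forall v, le v (dnext v)
    & forall v w, le v w -> le (dnext v) (dnext w)].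

Variable le : rel (deriv n).

(* v is the main derivative of A; an element of F has none. *)
Definition leader A v : Prop := occurs v A /\ forall w, occurs w A -> le w v.

Definition rank_lt A B : Prop :=
  exists v w, [/\ leader A v, leader B w
    & (v != w) && le v w \/ v = w /\ (degv v A < degv v B)%N].

Definition rank_eq A B : Prop :=
  exists v, [/\ leader A v, leader B v & degv v A = degv v B].

(* B is reduced with respect to A. *)
Definition reduced B A : Prop :=
  forall v, leader A v ->
    (degv v B < degv v A)%N /\ forall k, ~~ occurs (iter k.+1 (@dnext n) v) B.

(* An autoreduced set (chain), listed by increasing rank. *)
Definition autoreduced (s : seq (dpoly F n)) : Prop :=
  [/\ forall A, A \in s -> exists v, leader A v,
      forall i j, (i < j < size s)%N -> rank_lt s`_i s`_j
    & forall i j, (i < size s)%N -> (j < size s)%N -> i != j ->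
        reduced s`_i s`_j].

(* s is of lower rank than t; a proper extension of a chain is lower than it. *)
Definition chain_lt (s t : seq (dpoly F n)) : Prop :=
  (exists k, [/\ (k < size s)%N, (k < size t)%N,
      forall i, (i < k)%N -> rank_eq s`_i t`_i & rank_lt s`_k t`_k]) \/
  (size t < size s)%N /\ (forall i, (i < size t)%N -> rank_eq s`_i t`_i).

Definition chain_in P (s : seq (dpoly F n)) : Prop :=
  autoreduced s /\ forall A, A \in s -> P A.

Definition char_set P (s : seq (dpoly F n)) : Prop :=
  chain_in P s /\ forall t, chain_in P t -> ~ chain_lt t s.

End CharacteristicSets.

(* orders P, as a set of n-tuples. The characteristic set s, which is listed by
   increasing rank, is renumbered so that the main derivative of A j is a
   derivative of x_j. *)
Definition orders (F : fieldType) n (P : dpoly F n -> Prop)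
    (o : n.-tuple nat) : Prop :=
  exists (le : rel (deriv n)) (s : seq (dpoly F n)) (A : 'I_n -> dpoly F n),
    [/\ ranking le, char_set le P s, perm_eq s [seq A j | j <- enum 'I_n],
        forall j, exists k, leader le (A j) (j, k)
      & o = [tuple ordv j (A j) | j < n]].

(* Main.v *)
Require Import Defs.
From HB Require Import structures.
From mathcomp Require Import all_boot all_order all_algebra.
From mathcomp Require Import finmap.
From mathcomp.multinomials Require Import mpoly.
From mathcomp.multinomials Require Import monalg.
Import GRing.Theory.
Local Open Scope ring_scope.

Set Implicit Arguments.
Unset Strict Implicit.
Unset Printing Implicit Defensive.

(** The ideals are generated by linear differential polynomials with integer
    coefficients. Write [x_j^(k)] for the derivative [(j, k)].

    Consider a square matrix [M] of integer polynomials in the derivation, seen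
    as a system of linear equations whose [i]-th row is monic with leading term
    [x_i^(a i)] and otherwise involves only [x_j^(k)] with [k < a j]
    ([solved_for]). As a system of recurrences on sequences in an abelian group
    it has exactly one solution for given values of the [x_j^(k)], [k < a j]
    ([solve_solution], [solution_unique]). Taking the derivatives [x_j^(k)],
    [k < a j], themselves as initial values and substituting the solution for
    all derivatives is a retraction [normal_form] of the differential polynomial
    ring onto the polynomial ring in these finitely many derivatives. Its kernel
    [P] is prime, is closed under the derivation because integers are constants
    ([normal_form_dpderiv]), contains the rows, and meets that polynomial ring
    in 0. If a ranking makes the [x_i^(a i)] the leaders of the rows, the rows
    then form a characteristic set and every other characteristic set for this
    ranking has the same leaders ([leads_orders], [leads_char_set_orders]); such
    a ranking always exists ([leads_exists]).

    A system with the same solutions has the same ideal, by uniqueness of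
    solutions ([normal_form_comp]). Let [alpha 0 < ... < alpha K] be the elements
    of the prescribed set. It remains to find systems [M_0, ..., M_K] in two
    unknowns, with the same solutions and with orders
    [(alpha i, e - alpha i)], such that every ranking is adapted to at least one
    of them. They come from a Euclidean remainder sequence of rows
    [R_0, ..., R_(K+1)] with
    [R_(j+2) + R_j = X^(alpha (j+1) - alpha j) R_(j+1)], starting from a row in
    the second unknown alone and ending with a row in the first unknown alone.
    Its components are continuants: the first one of [R_(i+1)] has degree
    [alpha i] and the second one of [R_i] has degree [e - alpha i]. The system
    [M_i] consists of [R_(i+1)] and [R_i]; as in the Euclidean algorithm, all
    pairs of consecutive rows generate the same module
    ([eucl_system_solution]). For any ranking the leader of [R_0] is a
    derivative of the second unknown and that of [R_(K+1)] is a derivative of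
    the first one, so there are consecutive rows between which the leader passes
    from the second unknown to the first, and these form a system adapted to the
    ranking ([eucl_system_leads]). *)

(** * Substitutions in polynomial rings with arbitrarily many variables *)

Section Substitution.
Variables (F : fieldType) (V : choiceType).
Local Notation poly := {malg F[{cmonom V}]}.
Implicit Types (A B : poly) (m k : {cmonom V}) (v : V).

Section MonomialValue.
Variables (S : comNzRingType) (h : V -> S).

Definition monval m : S := \prod_(v <- finsupp m) h v ^+ m v.

Lemma monvalEw (D : {fset V}) m : (finsupp m `<=` D)%fset ->
  monval m = \prod_(v <- D) h v ^+ m v.
Proof.
move=> sD; apply: big_fset_incl => // v _.
by rewrite -cmE_eq0 => /eqP ->; rewrite expr0.
Qed.

Fact monval_mmorphism : mmorphism monval.
Proof.
split=> [m k|]; last by rewrite /monval mdom1 big_seq_fset0.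
rewrite (monvalEw (D := finsupp m `|` finsupp k)%fset) ?mdomD //.
rewrite (monvalEw (fsubsetUl (finsupp m) (finsupp k))).
rewrite (monvalEw (fsubsetUr (finsupp m) (finsupp k))) -big_split /=.
by apply: eq_bigr => v _; rewrite cmM exprD.
Qed.

HB.instance Definition _ :=
  monalg.isMultiplicative.Build {cmonom V} S monval monval_mmorphism.

Lemma monvalU v : monval (ucm v) = h v.
Proof. by rewrite /monval mdomU big_seq_fset1 cmUU expr1. Qed.

Variable f : {rmorphism F -> S}.

Definition subst : poly -> S := mmap f monval.

HB.instance Definition _ := GRing.RMorphism.on subst.

Lemma substC c : subst (malgC c) = f c.
Proof. exact: mmapC. Qed.

Lemma substX v : subst << ucm v >> = h v.
Proof.
rewrite /subst (mmapU (f := f)) monvalU -[RHS]mul1r; congr (_ * _).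
exact: rmorph1.
Qed.

End MonomialValue.

Lemma cmonom_ind (K : {cmonom V} -> Prop) :
  K mone -> (forall v m, K m -> K (mmul (ucm v) m)) -> forall m, K m.
Proof.
move=> K1 KM m; have [d] := ubnP (mdeg m); elim: d m => // d IH m.
have [m0|[v vm]] := fset_0Vmem (finsupp m).
  suff -> : m = mone by [].
  by apply/eqP; rewrite -mdeg_eq0 mdegE m0 big_seq_fset0.
have E : m = mmul (ucm v) (divcm m (ucm v)).
  apply/eqP/cmP => w; rewrite cmM divcmE cmU; case: eqVneq => [<-|_].
    by rewrite subnKC // lt0n cmE_neq0.
  by rewrite subn0.
rewrite [X in mdeg X]E mdegM mdegU ltnS => lt.
by rewrite E; apply: KM; apply: IH.
Qed.

Lemma mulUU a b m k :
  << a *g m >> * << b *g k >> = << a * b *g mmul m k >> :> poly.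
Proof. exact: fgmulUU. Qed.

Lemma monomialE c m : << c *g m >> = malgC c * << m >> :> poly.
Proof. by rewrite mulUU mulr1 monalg.mul1m. Qed.

Lemma malg_ind (K : poly -> Prop) :
  (forall c, K (malgC c)) -> (forall v, K << ucm v >>) ->
  (forall A B, K A -> K B -> K (A + B)) ->
  (forall A B, K A -> K B -> K (A * B)) -> forall A, K A.
Proof.
move=> KC KX KD KM A; rewrite (monalgE A); apply: (big_ind K) => [|//|m _].
  by have := KC 0; rewrite malgC0E.
suff Km : K << m >> by rewrite (monomialE _ m); exact: KM (KC _) Km.
elim/cmonom_ind: m => [|v m Km]; first exact: KC.
rewrite -[1]mulr1 -mulUU; exact: KM (KX v) Km.
Qed.

Lemma rmorph_eq_on_vars (S : comNzRingType) (f g : {rmorphism poly -> S}) A :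
  (forall c, f (malgC c) = g (malgC c)) ->
  (forall v m, m \in msupp A -> v \in finsupp m ->
     f << ucm v >> = g << ucm v >>) ->
  f A = g A.
Proof.
move=> eC eX; rewrite (monalgE A) (rmorph_sum f) (rmorph_sum g) big_seq [RHS]big_seq.
apply: eq_bigr => m mA; have {}eX v (vm : v \in finsupp m) := eX v m mA vm.
suff em : f << m >> = g << m >>.
  rewrite (monomialE _ m) (rmorphM f) (rmorphM g).
  exact: (congr2 *%R (eC _) em).
elim/cmonom_ind: m eX {mA} => [|v m IH] eX; first exact: eC.
rewrite -[1]mulr1 -mulUU (rmorphM f) (rmorphM g); congr (_ * _).
  by apply: eX; rewrite mdomD in_fsetU mdomU in_fset1 eqxx.
by apply: IH => w wm; apply: eX; rewrite mdomD in_fsetU wm orbT.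
Qed.

(** Since only finitely many variables occur in [A] and [B], the question takes
    place in a polynomial ring in finitely many variables, an integral domain;
    renaming the variables back recovers [A] and [B]. *)
Lemma malg_mulf_eq0 A B : A * B = 0 -> A = 0 \/ B = 0.
Proof.
move=> AB0.
pose D := enum_fset (\big[fsetU/fset0]_(m <- enum_fset (msupp A `|` msupp B))
                      finsupp m)%fset.
have memD m v :
    (m \in msupp A) || (m \in msupp B) -> v \in finsupp m -> v \in D.
  rewrite -in_fsetU => mAB vm; rewrite /D /= (big_fsetD1 m) //=.
  by rewrite in_fsetU vm.
pose hT v : mpoly.mpoly (size D) F :=
  if insub (index v D) is Some i then mpolyX _ (mnm1 i) else 0.
pose T := subst hT (mpolyC (size D) (R := F)).
pose hU (i : 'I_(size D)) : poly := << ucm (tnth (in_tuple D) i) >>.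
pose U := mpoly.mmap (@malgC _ F : F -> poly) hU.
have UT A' : (forall m, m \in msupp A' -> (m \in msupp A) || (m \in msupp B)) ->
    U (T A') = A'.
  move=> sA'; apply: (rmorph_eq_on_vars (f := U \o T) (g := idfun)).
    by move=> c; apply: etrans (congr1 U (substC _ _ _)) _; apply: mpoly.mmapC.
  move=> v m mA' vm; apply: etrans (congr1 U (substX _ _ _)) _.
  have vD := memD m v (sA' m mA') vm.
  have iD : (index v D < size D)%N by rewrite index_mem.
  rewrite /hT (insubT (fun i => i < size D)%N iD) /U.
  rewrite mpoly.mmapX mmap1U /hU.
  by rewrite (tnth_nth v) /= nth_index.
have TAB : T A * T B = 0 by rewrite -(rmorphM T) AB0; apply: rmorph0.
have U0 : U 0 = 0 by apply: raddf0.
have /orP [/eqP TA|/eqP TB] : (T A == 0) || (T B == 0) by rewrite -mulf_eq0 TAB.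
  by left; rewrite -(UT A) ?TA // => m ->.
by right; rewrite -(UT B) ?TB // => m ->; rewrite orbT.
Qed.

End Substitution.


(** * Linear recurrences with integer coefficients *)

Section ShiftAction.
Variable V : zmodType.
Implicit Types (p q : {poly int}) (z : nat -> V) (t : nat).

(** The polynomial [p] in the shift operator, applied to the sequence [z] and
    evaluated at [t]. When [z] lists the derivatives of an unknown, the shift is
    the derivation. *)
Definition shift_act p z t : V := \sum_(k < size p) z (t + k)%N *~ p`_k.

Lemma shift_actEw N p z t : (size p <= N)%N ->
  shift_act p z t = \sum_(k < N) z (t + k)%N *~ p`_k.
Proof.
move=> sN; rewrite /shift_act -(big_mkord xpredT (fun k => z (t + k)%N *~ p`_k)).
rewrite -(big_mkord xpredT (fun k => z (t + k)%N *~ p`_k)).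
rewrite (big_cat_nat (leq0n _) sN) /= [X in _ = _ + X]big_nat_cond.
rewrite [X in _ = _ + X]big1 ?addr0 //.
by move=> k /andP[/andP[sk _] _]; rewrite nth_default // mulr0z.
Qed.

Lemma shift_actB p q z t :
  shift_act (p - q) z t = shift_act p z t - shift_act q z t.
Proof.
pose N := maxn (size p) (size q).
rewrite (@shift_actEw N (p - q)) ?(leq_trans (size_polyD _ _)) ?size_polyN //.
rewrite (@shift_actEw N p) ?leq_maxl // (@shift_actEw N q) ?leq_maxr //.
by rewrite -sumrB; apply: eq_bigr => k _; rewrite coefB mulrzBr.
Qed.

Lemma shift_actXnM d p z t : shift_act ('X^d * p) z t = shift_act p z (t + d).
Proof.
rewrite (@shift_actEw (d + size p)); last first.
  by rewrite (leq_trans (size_polyMleq _ _)) // size_polyXn.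
rewrite big_split_ord /= big1 ?add0r => [|k _]; last first.
  by rewrite coefXnM ltn_ord mulr0z.
by apply: eq_bigr => k _; rewrite coefXnM ltnNge leq_addr /= addKn addnA.
Qed.

Lemma shift_act_monic d p z t : p \is monic -> size p = d.+1 ->
  shift_act p z t = z (t + d)%N + \sum_(k < d) z (t + k)%N *~ p`_k.
Proof.
move=> /monicP lp sp; rewrite /shift_act sp big_ord_recr /= addrC.
by move: lp; rewrite lead_coefE sp /= => ->.
Qed.

End ShiftAction.

Lemma raddf_shift_act (V W : zmodType) (f : {additive V -> W}) p z t :
  f (shift_act p z t) = shift_act p (f \o z) t.
Proof. by rewrite raddf_sum; apply: eq_bigr => k _; rewrite raddfMz. Qed.

Section Systems.
Variable n : nat.
Implicit Types (r : 'I_n -> {poly int}) (M : 'I_n -> 'I_n -> {poly int}).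
Implicit Types a : 'I_n -> nat.

Definition row_act (V : zmodType) r (Z : 'I_n -> nat -> V) t : V :=
  \sum_j shift_act (r j) (Z j) t.

Definition solution (V : zmodType) M (Z : 'I_n -> nat -> V) : Prop :=
  forall i t, row_act (M i) Z t = 0.

(** The normal form in which the [i]-th equation expresses [Z i (t + a i)]
    through the values [Z j (t + k)], [k < a j]. Once these are known, the
    equations at time [t] give exactly one more value of each sequence. *)
Definition solved_for a M : Prop :=
  (forall i, M i i \is monic /\ size (M i i) = (a i).+1) /\
  (forall i j, i != j -> (size (M i j) <= a j)%N).

Variables (V : zmodType) (a : 'I_n -> nat) (M : 'I_n -> 'I_n -> {poly int}).
Hypothesis sM : solved_for a M.
Implicit Types Z : 'I_n -> nat -> V.

Definition lower_part i Z t : V :=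
  \sum_j \sum_(k < a j) Z j (t + k)%N *~ (M i j)`_k.

Lemma row_act_solved i Z t :
  row_act (M i) Z t = Z i (t + a i)%N + lower_part i Z t.
Proof.
rewrite /row_act /lower_part (bigD1 i) //= [in RHS](bigD1 i) //= addrA.
have [[mi si] sij] := (sM.1 i, sM.2 i).
rewrite (shift_act_monic _ _ mi si); congr (_ + _); apply: eq_bigr => j ji.
by apply: shift_actEw; rewrite sij // eq_sym.
Qed.

Lemma lower_part_eq i Z Z' t :
  (forall j k, (k < a j)%N -> Z j (t + k)%N = Z' j (t + k)%N) ->
  lower_part i Z t = lower_part i Z' t.
Proof.
by move=> eZ; apply: eq_bigr => j _; apply: eq_bigr => k _; rewrite eZ.
Qed.

Lemma solution_unique Z Z' : solution M Z -> solution M Z' ->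
  (forall i k, (k < a i)%N -> Z i k = Z' i k) -> forall i k, Z i k = Z' i k.
Proof.
move=> sZ sZ' e0.
suff eqt t i k : (k < t + a i)%N -> Z i k = Z' i k.
  by move=> i k; apply: (eqt k.+1); rewrite addSn ltnS leq_addr.
elim: t i k => [|t IH] i k; first exact: e0.
rewrite addSn ltnS leq_eqVlt => /orP[/eqP ->|]; last exact: IH.
have := sZ i t; rewrite -(sZ' i t) !row_act_solved (@lower_part_eq i Z Z').
  exact: addIr.
by move=> j l lj; apply: IH; rewrite ltn_add2l.
Qed.

(** Windows: [w i k] stands for [Z i (t + k)], [k <= a i], at a moving [t]; the
    last value of each window is computed from the others. *)
Definition fill_window Z : 'I_n -> nat -> V :=
  fun i k => if (k < a i)%N then Z i k else - lower_part i Z 0.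

Fixpoint window Z0 t : 'I_n -> nat -> V :=
  if t is u.+1 then fill_window (fun i k => window Z0 u i k.+1)
  else fill_window Z0.

Definition solve Z0 : 'I_n -> nat -> V := fun i t => window Z0 t i 0.

Lemma windowE Z0 t i k : (k <= a i)%N -> window Z0 t i k = solve Z0 i (t + k)%N.
Proof.
elim: k t => [|k IH] t lk; first by rewrite addn0.
by rewrite -addSnnS -IH 1?ltnW //= /fill_window lk.
Qed.

Lemma solve_init Z0 i k : (k < a i)%N -> solve Z0 i k = Z0 i k.
Proof.
by move=> lk; rewrite -[k]add0n -windowE 1?ltnW //= /fill_window lk add0n.
Qed.

Lemma solve_solution Z0 : solution M (solve Z0).
Proof.
move=> i t; rewrite row_act_solved -windowE //.
have [Y wY] : exists Y, window Z0 t = fill_window Y by case: t => [|t] /=; eexists.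
rewrite {1}wY /fill_window ltnn; apply/eqP; rewrite addrC subr_eq0; apply/eqP.
apply: eq_bigr => j _; apply: eq_bigr => k _.
by rewrite -windowE 1?ltnW // wY /fill_window ltn_ord.
Qed.

End Systems.

Lemma raddf_row_act n (V W : zmodType) (f : {additive V -> W}) r
    (Z : 'I_n -> nat -> V) t :
  f (row_act r Z t) = row_act r (fun j k => f (Z j k)) t.
Proof. by rewrite raddf_sum; apply: eq_bigr => j _; rewrite raddf_shift_act. Qed.

(** * The ideal of a linear system *)

Section SystemIdeal.
Variables (F : fieldType) (n : nat).
Implicit Types (A B : dpoly F n) (v w : 'I_n * nat).
Implicit Types (M : 'I_n -> 'I_n -> {poly int}) (a : 'I_n -> nat).

Definition unknowns (j : 'I_n) k : dpoly F n := << ucm (j, k) >>.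

(** The unknowns below the orders [a] are their own images ([solve_init]), so the
    substitution is a retraction onto the polynomial ring in these unknowns.
    Only its values on constants and unknowns matter, and it is kept opaque. *)
Fact normal_form_subproof a M : {f : {rmorphism dpoly F n -> dpoly F n} |
  (forall c, f (malgC c) = malgC c) /\
  (forall j k, f (unknowns j k) = solve a M unknowns j k)}.
Proof.
exists (subst (fun v => solve a M unknowns v.1 v.2) (@malgC _ F : F -> dpoly F n)).
by split=> [c|j k]; [apply: substC | apply: substX].
Qed.

Definition normal_form a M := sval (normal_form_subproof a M).

Definition system_ideal a M A : Prop := normal_form a M A = 0.

Definition row_poly (r : 'I_n -> {poly int}) : dpoly F n := row_act r unknowns 0.

Lemma normal_formC a M c : normal_form a M (malgC c) = malgC c.
Proof. by case: (svalP (normal_form_subproof a M)). Qed.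

Lemma normal_formX a M j k :
  normal_form a M (unknowns j k) = solve a M unknowns j k.
Proof. by case: (svalP (normal_form_subproof a M)). Qed.

Lemma normal_form_fixed a M A :
  (forall m v, m \in msupp A -> v \in finsupp m -> (v.2 < a v.1)%N) ->
  normal_form a M A = A.
Proof.
move=> lowA; apply: (rmorph_eq_on_vars (f := normal_form a M) (g := idfun)).
  exact: normal_formC.
case=> j k m mA vm; apply: etrans (normal_formX _ _ _ _) _.
by apply: solve_init; apply: (lowA m (j, k)).
Qed.

(** A substitution maps solutions of recurrences with integer coefficients to
    solutions. The image of the generic solution of [M] under the normal form of
    [M'] and the generic solution of [M'] are two solutions of [M] with the same
    initial values, so they agree. *)
Lemma normal_form_comp a M a' M' : solved_for a M -> solved_for a' M' ->
  (forall Z : 'I_n -> nat -> dpoly F n, solution M' Z -> solution M Z) ->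
  forall A, normal_form a' M' (normal_form a M A) = normal_form a' M' A.
Proof.
move=> sM sM' imp A.
apply: (rmorph_eq_on_vars (f := normal_form a' M' \o normal_form a M)
                          (g := normal_form a' M')).
  move=> c; apply: etrans (congr1 _ (normal_formC _ _ _)) _; exact: erefl.
case=> j k m mA vm; apply: etrans (congr1 _ (normal_formX a M j k)) _.
apply: etrans (esym (normal_formX a' M' j k)).
apply: (solution_unique sM _ _ (Z := fun j k => _ (solve a M unknowns j k))).
- move=> i t; rewrite -raddf_row_act (solve_solution sM); exact: raddf0.
- by apply: imp; apply: solve_solution.
- move=> i l li; rewrite solve_init //; exact: normal_formX.
Qed.

Lemma system_idealW a M a' M' : solved_for a M -> solved_for a' M' ->
  (forall Z : 'I_n -> nat -> dpoly F n, solution M' Z -> solution M Z) ->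
  forall A, system_ideal a M A -> system_ideal a' M' A.
Proof.
move=> sM sM' imp A A0; rewrite /system_ideal -(normal_form_comp sM sM' imp) A0.
exact: raddf0.
Qed.

Lemma row_poly_in_ideal a M r : solved_for a M ->
  (forall Z : 'I_n -> nat -> dpoly F n, solution M Z ->
     forall t, row_act r Z t = 0) ->
  system_ideal a M (row_poly r).
Proof.
move=> sM imp; apply: etrans (raddf_row_act _ _ _ _) _.
have sZ := solve_solution sM unknowns.
rewrite -[RHS](imp _ sZ 0%N); apply: eq_bigr => j _; apply: eq_bigr => k _.
by congr (_ *~ _); apply: normal_formX.
Qed.

Lemma system_ideal_low0 a M A : system_ideal a M A ->
  (forall m v, m \in msupp A -> v \in finsupp m -> (v.2 < a v.1)%N) -> A = 0.
Proof. by move=> A0 /(normal_form_fixed M) <-. Qed.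

Section Prime.
Variables (d : F -> F) (hd : derivation d).
Variables (a : 'I_n -> nat) (M : 'I_n -> 'I_n -> {poly int}).
Hypothesis sM : solved_for a M.
Local Notation nf := (normal_form a M).

Fact nf_dpderiv_additive : additive (fun A => nf (dpderiv d A)).
Proof.
have [dD _] := dpderiv_derivation hd n.
have add A B : nf (dpderiv d (A + B)) = nf (dpderiv d A) + nf (dpderiv d B).
  by rewrite dD; apply: raddfD.
move=> A B; apply: (addIr (nf (dpderiv d B))); apply: etrans (esym (add _ _)) _.
apply: etrans (esym (subrK _ _)).
exact: (congr1 (fun C => nf (dpderiv d C)) (subrK _ _)).
Qed.

Let D : {additive dpoly F n -> dpoly F n} :=
  HB.pack (fun A => nf (dpderiv d A))
    (GRing.isAdditive.Build _ _ _ nf_dpderiv_additive).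

(** As functions of [A] both sides are derivations along [nf] that extend [d], so
    it suffices to compare them at the unknowns. There both are solutions of
    [M], with the same initial values: the left side because additive maps
    preserve solutions, the right side because it is a shifted solution. *)
Lemma normal_form_dpderiv A : nf (dpderiv d (nf A)) = nf (dpderiv d A).
Proof.
have [_ dM] := dpderiv_derivation hd n.
have DM A1 A2 : D (A1 * A2) = D A1 * nf A2 + nf A1 * D A2.
  apply: etrans (congr1 nf (dM A1 A2)) _; apply: etrans (raddfD nf _ _) _.
  exact: (congr2 +%R (rmorphM nf _ _) (rmorphM nf _ _)).
elim/malg_ind: A => [c|[j k]|A B IA IB|A B IA IB].
- exact: (congr1 (fun B => nf (dpderiv d B)) (normal_formC _ _ _)).
- apply: etrans (congr1 (fun B => nf (dpderiv d B)) (normal_formX a M j k)) _.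
  apply: etrans (esym (congr1 nf (dpderivX hd (j, k)))).
  apply: etrans (esym (normal_formX a M j k.+1)).
  apply: (solution_unique sM (Z := fun j k => D (solve a M unknowns j k))
                            (Z' := fun j k => solve a M unknowns j k.+1)).
  + by move=> i t; rewrite -raddf_row_act (solve_solution sM) raddf0.
  + by move=> i t; rewrite -(solve_solution sM unknowns i t.+1).
  + move=> i l li; rewrite solve_init //=.
    apply: etrans (congr1 nf (dpderivX hd (i, l))) _; exact: normal_formX.
- apply: etrans (congr1 D (raddfD nf A B)) _.
  apply: etrans (raddfD D _ _) _; apply: etrans (congr2 +%R IA IB) _.
  exact: (esym (raddfD D A B)).
- have idem C : nf (nf C) = nf C by apply: (normal_form_comp sM sM).
  apply: etrans (congr1 D (rmorphM nf A B)) _; apply: etrans (DM _ _) _.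
  apply: etrans (esym (DM A B)).
  exact: (congr2 +%R (congr2 *%R IA (idem B)) (congr2 *%R (idem A) IB)).
Qed.

Lemma system_ideal_prime : prime_diff_ideal d (system_ideal a M).
Proof.
split; [split | | | |]; rewrite /system_ideal.
- exact: raddf0.
- move=> A B A0 B0.
  exact: etrans (raddfD nf A B) (etrans (congr2 +%R A0 B0) (addr0 _)).
- move=> A B B0.
  exact: etrans (rmorphM nf A B) (etrans (congr1 ( *%R (nf A)) B0) (mulr0 _)).
- move=> A A0; apply: etrans (esym (normal_form_dpderiv A)) _.
  exact: etrans (congr1 D A0) (raddf0 D).
- move=> nf1; have := oner_neq0 (dpoly F n).
  by rewrite -(rmorph1 nf) nf1 eqxx.
- move=> A B AB0; apply: malg_mulf_eq0.
  exact: etrans (esym (rmorphM nf A B)) AB0.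
Qed.

End Prime.
End SystemIdeal.

(** * Characteristic sets that are linear in their leaders *)

Section Occurrences.
Variables (F : fieldType) (n : nat).
Implicit Types (A B : dpoly F n) (v w : 'I_n * nat).

Lemma occursP v A :
  reflect (exists2 m, m \in msupp A & v \in finsupp m) (occurs v A).
Proof.
rewrite /occurs /degv; apply: (iffP idP) => [|[m mA vm]]; last first.
  have: (m v <= \max_(m0 <- msupp A) m0 v)%N.
    by rewrite (big_fsetD1 m) //= leq_maxl.
  by apply: leq_trans; rewrite lt0n cmE_neq0.
case: (boolP (has (fun m : {cmonom _} => v \in finsupp m) (msupp A))).
  by move=> /hasP [m mA vm] _; exists m.
move=> /hasPn none; rewrite big_seq big1 // => m /none.
by rewrite -cmE_neq0 negbK => /eqP.
Qed.

End Occurrences.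

Section LeadersOfCharacteristicSets.
Variables (F : fieldType) (n : nat) (P : dpoly F n -> Prop).
Variable le : rel ('I_n * nat).
Implicit Types (A C : dpoly F n) (v w : 'I_n * nat) (s t : seq (dpoly F n)).
Hypothesis rk : ranking le.

Let le_total : total le. Proof. by case: rk. Qed.
Let le_trans : transitive le. Proof. by case: rk. Qed.
Let le_anti : antisymmetric le. Proof. by case: rk. Qed.

Lemma ranking_le_order j k l : (k <= l)%N -> le (j, k) (j, l).
Proof.
have [_ _ _ le_next _] := rk.
elim: l => [|l IH]; first by rewrite leqn0 => /eqP ->; case/orP: (le_total (j, 0%N) (j, 0%N)).
rewrite leq_eqVlt => /orP[/eqP ->|/IH le_kl].
  by case/orP: (le_total (j, l.+1) (j, l.+1)).
exact: le_trans le_kl (le_next (j, l)).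
Qed.

Lemma leader_unique A v w : leader le A v -> leader le A w -> v = w.
Proof. by move=> [ov lv] [ow lw]; apply: le_anti; rewrite lw // lv. Qed.

Lemma ordv_leader A j k : leader le A (j, k) -> ordv j A = k.
Proof.
move=> [/occursP [m mA vm] lv]; apply/eqP; rewrite eqn_leq; apply/andP; split.
  rewrite /ordv big_seq.
  apply: (big_ind (fun x => x <= k)%N) => // [x y|m' m'A].
    by rewrite geq_max => -> ->.
  rewrite big_seq_cond.
  apply: (big_ind (fun x => x <= k)%N) => // [x y|[j' l] /= /andP[om /eqP Ej]].
    by rewrite geq_max => -> ->.
  rewrite {j'}Ej in om *; rewrite leqNgt; apply/negP => kl.
  have jl : le (j, l) (j, k) by apply: lv; apply/occursP; exists m'.
  have [Elk] : (j, l) = (j, k) by apply: le_anti; rewrite jl ranking_le_order // ltnW.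
  by rewrite Elk ltnn in kl.
rewrite /ordv (big_fsetD1 m) //= leq_max; apply/orP; left.
by rewrite big_mkcond (big_fsetD1 (j, k)) //= eqxx leq_maxl.
Qed.

(** In the intended case [P] is the ideal of a linear system, the [B j] are its
    equations, and the [(j, k)], [k < a j], form a transcendence basis modulo
    [P]. *)
Variables (a : 'I_n -> nat) (B : 'I_n -> dpoly F n).
Hypothesis PB : forall j, P (B j).
Hypothesis leadB : forall j, leader le (B j) (j, a j).
Hypothesis degB : forall j, degv (j, a j) (B j) = 1%N.
Hypothesis lowB : forall i j k, i != j -> occurs (j, k) (B i) -> (k < a j)%N.
Hypothesis lowP : forall A, P A ->
  (forall j k, occurs (j, k) A -> (k < a j)%N) -> A = 0.

Let by_leader : rel 'I_n := fun i j => le (i, a i) (j, a j).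
Let sigma := sort by_leader (enum 'I_n).
Let s0 := [seq B j | j <- sigma].

Let mem_sigma j : j \in sigma.
Proof. by rewrite mem_sort mem_enum. Qed.

Let size_s0 : size s0 = n.
Proof. by rewrite size_map size_sort size_enum_ord. Qed.

Let index_sigma j : (index j sigma < n)%N.
Proof. by rewrite -[X in (_ < X)%N]size_s0 size_map index_mem. Qed.

Let s0_index j : s0`_(index j sigma) = B j.
Proof. by rewrite (nth_map j) ?index_mem ?nth_index. Qed.

Let indexP k : (k < n)%N -> exists j, k = index j sigma.
Proof.
move=> kn; have j0 : 'I_n := Ordinal kn.
exists (nth j0 sigma k); rewrite index_uniq ?sort_uniq ?enum_uniq //.
by rewrite size_sort size_enum_ord.
Qed.

Let le_leaders i j : (index i sigma <= index j sigma)%N -> le (i, a i) (j, a j).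
Proof.
rewrite leq_eqVlt => /orP[/eqP /(congr1 (nth i sigma))|].
  by rewrite !nth_index // => ->; apply: ranking_le_order.
apply: (sorted_ltn_index (leT := by_leader)) => //.
  by move=> x y z; apply: le_trans.
by apply: sort_sorted => x y; apply: le_total.
Qed.

Let reduced_low A C j : reduced le A C -> leader le C (j, a j) ->
  degv (j, a j) C = 1%N -> forall k, occurs (j, k) A -> (k < a j)%N.
Proof.
move=> redA lC dC k; have [] := redA _ lC; rewrite dC ltnS leqn0 => dA nA okA.
rewrite ltnNge leq_eqVlt; apply/norP; split.
  by apply: contraTN okA => /eqP <-; rewrite /occurs (eqP dA).
apply: contraTN okA => lk.
suff <- : iter (k - a j).-1.+1 (@dnext n) (j, a j) = (j, k) by apply: nA.
have it l : iter l (@dnext n) (j, a j) = (j, (l + a j)%N).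
  by elim: l => //= l ->.
by rewrite it prednK ?subn_gt0 // subnK // ltnW.
Qed.

Let s0_chain : chain_in le P s0.
Proof.
split; last by move=> A /mapP [j _ ->].
split.
- by move=> A /mapP [j _ ->]; exists (j, a j).
- move=> i j; rewrite size_s0 => /andP[ij jn].
  have [[i' Ei] [j' Ej]] := (indexP (ltn_trans ij jn), indexP jn).
  rewrite Ei Ej !s0_index; exists (i', a i'), (j', a j'); split=> //; left.
  rewrite le_leaders -?Ei -?Ej 1?ltnW // andbT.
  apply: contraTneq ij => -[Eij _]; by rewrite Ei Ej Eij ltnn.
- move=> i j; rewrite size_s0 => lin ljn ij.
  have [[i' Ei] [j' Ej]] := (indexP lin, indexP ljn).
  have {}ij : i' != j' by apply: contraNneq ij => E; rewrite Ei Ej E.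
  rewrite Ei Ej !s0_index => v /leader_unique - /(_ _ (leadB j')) ->.
  split=> [|k].
    rewrite degB ltnNge; apply/negP => /(lowB ij); by rewrite ltnn.
  have -> : iter k.+1 (@dnext n) (j', a j') = (j', (k.+1 + a j')%N).
    by elim: k => //= k ->.
  by apply/negP => /(lowB ij); rewrite ltnNge leq_addl.
Qed.

(** The first [k] elements of [t] are linear in the first [k] leaders of [s0], so
    their reducedness condition excludes these leaders and their derivatives from
    [t`_k]; by [lowP] a derivative of some other leader of [s0] must occur. *)
Let chain_high t k : chain_in le P t -> (k < size t)%N -> (k <= n)%N ->
  (forall i, (i < k)%N -> rank_eq le t`_i s0`_i) ->
  exists j l, [/\ (k <= index j sigma)%N, (a j <= l)%N & occurs (j, l) t`_k].
Proof.
move=> [[leadt _ redt] Pt] kt kn eqt.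
have low j l : (index j sigma < k)%N -> occurs (j, l) t`_k -> (l < a j)%N.
  move=> jk; have [v [tv sv dv]] := eqt _ jk.
  rewrite s0_index in sv dv.
  rewrite (leader_unique sv (leadB j)) degB in tv dv.
  apply: reduced_low tv dv _; apply: redt => //; first exact: ltn_trans jk kt.
  by rewrite eq_sym neq_ltn jk.
have tk0 : t`_k <> 0.
  have [v [/occursP [m]]] := leadt _ (mem_nth 0 kt).
  by move=> mt _ _ t0; rewrite t0 msupp0 in mt.
pose high v := (k <= index v.1 sigma)%N && (a v.1 <= v.2)%N.
case: (boolP (has (fun m : {cmonom _} => has high (finsupp m)) (msupp t`_k))).
  move=> /hasP [m mt /hasP [[j l] jlm /andP[kj jl]]].
  by exists j, l; split=> //; apply/occursP; exists m.
move=> /hasPn none; case: tk0; apply: lowP; first exact: Pt (mem_nth 0 kt).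
move=> j l ojl; case: (ltnP (index j sigma) k) => [jk|kj]; first exact: low ojl.
have /occursP [m mt jlm] := ojl; rewrite ltnNge; apply/negP => jl.
by have /hasPn /(_ _ jlm) := none m mt; rewrite /high kj jl.
Qed.

(** At the first place where a lower chain is lower or longer, [chain_high] yields
    a derivative that is not below all the remaining leaders of [s0]; but if there
    are any, the element in question has a leader strictly below them. *)
Lemma leading_chain_char_set : char_set le P s0.
Proof.
split; first exact: s0_chain.
move=> t ct [[k [kt ks eqt [v [w [lv lw vw]]]]]|[st eqt]]; last first.
  rewrite size_s0 in st eqt.
  have [j [l [nj _ _]]] := chain_high ct st (leqnn n) eqt.
  by have := index_sigma j; rewrite ltnNge nj.
rewrite size_s0 in ks; have [j [l [kj jl ol]]] := chain_high ct kt (ltnW ks) eqt.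
have [i Ei] := indexP ks; rewrite {}Ei in lv lw vw kj ol *.
rewrite s0_index in lw vw; rewrite (leader_unique lw (leadB i)) in vw.
have v_max : le (i, a i) v.
  apply: le_trans (le_leaders kj) (le_trans (ranking_le_order j jl) _).
  exact: lv.2.
case: vw => [/andP[ne vi]|[Ev]].
  by case/eqP: ne; apply: le_anti; rewrite vi.
by rewrite Ev degB ltnNge => /negP; apply; rewrite -Ev; exact: lv.1.
Qed.

(** Two characteristic sets for the same ranking have the same ranks, by minimality
    of each of them; the ranks of [s0] are known. *)
Lemma char_set_leader s : char_set le P s -> size s = n ->
  forall j, exists2 A, A \in s & leader le A (j, a j).
Proof.
move=> [cs mins] ss.
have [_ mins0] := leading_chain_char_set.
have eqs k : (k < n)%N -> rank_eq le s`_k s0`_k.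
  elim/ltn_ind: k => k IH kn.
  have {}IH i : (i < k)%N -> rank_eq le s`_i s0`_i.
    by move=> ik; apply: IH => //; apply: ltn_trans kn.
  have [w lw] : exists w, leader le s0`_k w.
    by have [j ->] := indexP kn; exists (j, a j); rewrite s0_index.
  have [v lv] : exists v, leader le s`_k v.
    by have [[lead_s _ _] _] := cs; apply: lead_s; rewrite mem_nth ?ss.
  have lt1 : ~ rank_lt le s`_k s0`_k.
    by move=> lt; apply: (mins0 s cs); left; exists k; rewrite ss size_s0.
  have lt2 : ~ rank_lt le s0`_k s`_k.
    move=> lt; apply: (mins s0 s0_chain); left; exists k.
    rewrite ss size_s0; split=> // i ik; have [u [u1 u2 u3]] := IH i ik.
    by exists u.
  have Evw : v = w.
    apply/eqP; apply/negPn/negP => ne; case/orP: (le_total v w) => [vw|wv].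
      by apply: lt1; exists v, w; split=> //; left; rewrite ne.
    by apply: lt2; exists w, v; split=> //; left; rewrite eq_sym ne.
  rewrite {}Evw in lv; exists w; split=> //.
  case: (ltngtP (degv w s`_k) (degv w s0`_k)) => // lt.
    by case: lt1; exists w, w; split=> //; right.
  by case: lt2; exists w, w; split=> //; right.
move=> j; have [v [lv lB _]] := eqs _ (index_sigma j).
rewrite s0_index in lB; rewrite (leader_unique lB (leadB j)) in lv.
by exists s`_(index j sigma) => //; rewrite mem_nth // ss.
Qed.

Lemma orders_of_leading_chain : orders P [tuple a j | j < n].
Proof.
exists le, s0, B; split=> //.
- exact: leading_chain_char_set.
- by apply: perm_map; rewrite perm_sort.
- by move=> j; exists (a j).
- by apply: eq_from_tnth => j; rewrite !tnth_mktuple (ordv_leader (leadB j)).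
Qed.

Lemma char_set_orders s (A : 'I_n -> dpoly F n) : char_set le P s ->
  perm_eq s [seq A j | j <- enum 'I_n] ->
  (forall j, exists k, leader le (A j) (j, k)) -> forall j, ordv j (A j) = a j.
Proof.
move=> cs sA leadA j.
have ss : size s = n by rewrite (perm_size sA) size_map size_enum_ord.
have [C Cs lC] := char_set_leader cs ss j.
move: Cs; rewrite (perm_mem sA) => /mapP [i _ EC].
have [k lk] := leadA i; rewrite EC in lC.
by have [Eij _] := leader_unique lC lk; rewrite Eij in lC *; apply: ordv_leader.
Qed.

End LeadersOfCharacteristicSets.

Section RowPolynomials.
Variables (F : fieldType) (n : nat) (r : 'I_n -> {poly int}).
Local Notation R := (row_poly F r).

Lemma ucm_eq (v w : 'I_n * nat) : (ucm v == ucm w) = (v == w).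
Proof.
apply/eqP/eqP => [E|-> //]; apply/eqP; rewrite -(eqb1 (v == w)).
by rewrite -cmU E cmUU.
Qed.

Lemma mcoeff_row_poly m : mcoeff m R =
  \sum_j \sum_(k < size (r j)) (ucm (j, k : nat) == m)%:R *~ (r j)`_k.
Proof.
rewrite raddf_sum; apply: eq_bigr => j _; rewrite raddf_sum.
by apply: eq_bigr => k _; rewrite raddfMz; congr (_ *~ _); apply: mcoeffU1.
Qed.

Lemma msupp_row_poly m : m \in msupp R ->
  exists j k, m = ucm (j, k) /\ (k < size (r j))%N.
Proof.
rewrite -mcoeff_neq0 mcoeff_row_poly.
case: (boolP [exists j, [exists k : 'I_(size (r j)), ucm (j, k : nat) == m]]).
  by move=> /existsP [j /existsP [k /eqP <-]] _; exists j, (nat_of_ord k).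
move=> /existsPn none; rewrite big1 ?eqxx // => j _.
rewrite big1 // => k _; have /existsPn /(_ k) /negbTE -> := none j.
exact: mul0rz.
Qed.

Lemma occurs_row_poly j k : occurs (j, k) R -> (k < size (r j))%N.
Proof.
move=> /occursP [m /msupp_row_poly [j' [k' [-> lk]]]].
by rewrite mdomU in_fset1 => /eqP [-> ->].
Qed.

Lemma occurs_row_poly_monic j k : r j \is monic -> size (r j) = k.+1 ->
  occurs (j, k) R.
Proof.
move=> /monicP rj sj; apply/occursP; exists (ucm (j, k)); last first.
  by rewrite mdomU in_fset1.
rewrite -mcoeff_neq0 mcoeff_row_poly (bigD1 j) //= sj big_ord_recr /= eqxx.
have -> : (r j)`_k = 1 by rewrite -rj lead_coefE sj.
rewrite big1 ?add0r => [|l _]; last first.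
  rewrite ucm_eq; suff /negbTE -> : (j, l : nat) != (j, k) by exact: mul0rz.
  by apply/eqP => -[E]; have := ltn_ord l; rewrite E ltnn.
rewrite big1 ?addr0 => [|i ij]; first by rewrite mulr1z oner_eq0.
rewrite big1 // => l _; rewrite ucm_eq.
suff /negbTE -> : (i, l : nat) != (j, k) by exact: mul0rz.
by apply: contraNneq ij => -[Eij _]; rewrite Eij.
Qed.

Lemma degv_row_poly v : occurs v R -> degv v R = 1%N.
Proof.
move=> ov; apply/eqP; rewrite eqn_leq {}[X in _ && X]ov andbT /degv big_seq.
apply: (big_ind (fun x => x <= 1)%N) => // [x y|m /msupp_row_poly [j [k [-> _]]]].
  by rewrite geq_max => -> ->.
by rewrite cmU leq_b1.
Qed.

Lemma leader_row_poly (le : rel ('I_n * nat)) i l : ranking le ->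
  r i \is monic -> size (r i) = l.+1 ->
  (forall j k, j != i -> (k < size (r j))%N -> le (j, k) (i, l)) ->
  leader le R (i, l).
Proof.
move=> rk ri si low; split; first exact: occurs_row_poly_monic.
case=> j k /occurs_row_poly lk; have [Ej|] := eqVneq j i; last first.
  by move=> ji; apply: low.
by rewrite Ej si ltnS in lk *; apply: ranking_le_order.
Qed.

End RowPolynomials.

(** * Orders of the ideal of a linear system *)

Section SystemOrders.
Variables (F : fieldType) (n : nat).
Variables (a0 a : 'I_n -> nat) (M0 M : 'I_n -> 'I_n -> {poly int}).
Hypotheses (sM0 : solved_for a0 M0) (sM : solved_for a M).
Hypothesis same : forall Z : 'I_n -> nat -> dpoly F n,
  solution M0 Z <-> solution M Z.
Local Notation P := (system_ideal (F := F) a0 M0).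

(** The ranking makes [(i, a i)] the leader of the [i]-th row: within the unknown
    [i] every ranking orders the derivatives in the same way, so that only the
    other unknowns have to be compared. *)
Definition leads (le : rel ('I_n * nat)) : Prop :=
  forall i j k, j != i -> (k < size (M i j))%N -> le (j, k) (i, a i).

Section WithRanking.
Variable le : rel ('I_n * nat).
Hypotheses (rk : ranking le) (lead : leads le).

Let PB i : P (row_poly F (M i)).
Proof. by apply: row_poly_in_ideal => // Z /same sZ t; apply: sZ. Qed.

Let leadB i : leader le (row_poly F (M i)) (i, a i).
Proof.
have [mi si] := sM.1 i; apply: leader_row_poly => // j k ji; exact: lead.
Qed.

Let degB i : degv (i, a i) (row_poly F (M i)) = 1%N.
Proof. by apply: degv_row_poly; case: (leadB i). Qed.

Let lowB i j k : i != j -> occurs (j, k) (row_poly F (M i)) -> (k < a j)%N.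
Proof.
by move=> ij /occurs_row_poly lk; apply: leq_trans lk _; apply: sM.2.
Qed.

Let lowP A : P A -> (forall j k, occurs (j, k) A -> (k < a j)%N) -> A = 0.
Proof.
move=> PA low; apply: (system_ideal_low0 (a := a) (M := M)).
  by apply: system_idealW PA => // Z /same.
by move=> m [j k] mA vm; apply: low; apply/occursP; exists m.
Qed.

Lemma leads_orders : orders P [tuple a j | j < n].
Proof.
exact: (orders_of_leading_chain (P := P) (B := fun i => row_poly F (M i))
  rk PB leadB degB lowB lowP).
Qed.

Lemma leads_char_set_orders s (A : 'I_n -> dpoly F n) : char_set le P s ->
  perm_eq s [seq A j | j <- enum 'I_n] ->
  (forall j, exists k, leader le (A j) (j, k)) -> forall j, ordv j (A j) = a j.
Proof.
exact: (char_set_orders (P := P) (B := fun i => row_poly F (M i))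
  rk PB leadB degB lowB lowP (s := s) (A := A)).
Qed.

End WithRanking.

(** The ranking by the weight [k - a j] of [(j, k)], normalized to be
    nonnegative, with ties broken by the unknown: all leaders of the system have
    the same weight, and all other derivatives in its rows a smaller one. *)
Lemma leads_exists : exists2 le, ranking le & leads le.
Proof.
pose N := \sum_j a j.
have aN j : (a j <= N)%N by rewrite /N (bigD1 j) //= leq_addr.
pose wt (v : 'I_n * nat) := (v.2 + (N - a v.1))%N.
exists (fun v w => (wt v < wt w)%N || (wt v == wt w) && (v.1 <= w.1)%N).
  split=> [v w|w u v|v w|v|v w].
  - case: (ltngtP (wt v) (wt w)) => //= _; exact: leq_total.
  - case/orP=> [vw|/andP[/eqP -> vw]]; case/orP=> [wu|/andP[/eqP <- wu]].
    + by rewrite (ltn_trans vw wu).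
    + by rewrite vw.
    + by rewrite wu.
    + by rewrite eqxx (leq_trans vw wu) orbT.
  - case: (ltngtP (wt v) (wt w)) => //= E; rewrite -eqn_leq => /eqP/val_inj E1.
    case: v w E E1 => [v1 v2] [w1 w2] /= + E1; rewrite /wt /= E1.
    by move/addIn ->.
  - by rewrite /wt /= addSn ltnSn.
  - by rewrite /wt /= !addSn ltnS eqSS.
move=> i j k ji lk; apply/orP; left; rewrite /wt /= subnKC //.
have lkj : (k < a j)%N by apply: leq_trans lk (sM.2 _ _ _); rewrite eq_sym.
by rewrite -[X in (_ < X)%N](subnKC (aN j)) ltn_add2r.
Qed.

Lemma system_orders : orders P [tuple a j | j < n].
Proof. by have [le rk lead] := leads_exists; apply: leads_orders rk lead. Qed.

End SystemOrders.

(** * Continuants *)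

Section Continuants.

(** Continuants of the monomials ['X^(g 0)], ['X^(g 1 - g 0)], and so on, with the
    sign in the recurrence chosen so that they are monic; for increasing [g] the
    degrees of the nonzero ones are the values of [g]. *)
Fixpoint continuant (g : nat -> nat) m : {poly int} :=
  if m isn't m'.+1 then 0 else
  if m' isn't k.+1 then 'X^(g 0) else
  'X^(g k.+1 - g k) * continuant g m' - continuant g k.

Lemma continuantSS g m : continuant g m.+2 =
  'X^(g m.+1 - g m) * continuant g m.+1 - continuant g m.
Proof. by []. Qed.

Lemma continuant_monic g K : (forall m, (m < K)%N -> (g m < g m.+1)%N) ->
  forall m, (m <= K)%N ->
  continuant g m.+1 \is monic /\ size (continuant g m.+1) = (g m).+1.
Proof.
move=> g_incr m; have [d] := ubnP m; elim: d m => // d IH [|m] md mK.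
  by rewrite /= monicXn size_polyXn.
have [mon sz] := IH m md (ltnW mK); have gm := g_incr m mK.
have sX : size ('X^(g m.+1 - g m) * continuant g m.+1) = (g m.+1).+1.
  rewrite size_monicM ?monicXn ?monic_neq0 // size_polyXn sz.
  by rewrite addSn /= addnS subnK // ltnW.
have small : (size (- continuant g m) < (g m.+1).+1)%N.
  rewrite size_polyN; case: m {sX} md mK mon sz gm => [|m] md mK mon sz gm.
    by rewrite size_poly0.
  have [_ ->] := IH m (ltnW md) (ltnW (ltnW mK)).
  by rewrite ltnS (leq_trans (g_incr m (ltnW mK))) // ltnW.
rewrite continuantSS monicE lead_coefDl ?sX // size_polyDl ?sX //.
by split=> //; rewrite -monicE monicMl // monicXn.
Qed.

Lemma size_continuant g K : (forall m, (m < K)%N -> (g m < g m.+1)%N) ->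
  forall m, (m <= K)%N -> (size (continuant g m) <= g m)%N.
Proof.
move=> g_incr [|m] mK; first by rewrite size_poly0.
by have [_ ->] := continuant_monic g_incr (ltnW mK); apply: g_incr.
Qed.

End Continuants.

(** * The system with prescribed orders *)

Section PrescribedOrders.
Variables (alpha : nat -> nat) (K e : nat).
Hypothesis alpha_incr : forall i, (i < K)%N -> (alpha i < alpha i.+1)%N.
Hypothesis alpha_le : forall i, (i <= K)%N -> (alpha i <= e)%N.
Implicit Types (i j k m t : nat) (c r : 'I_2).

Let ord2_neq0 c : c != ord0 -> c = ord_max.
Proof. by case: c => -[|[|m]] // lt _; apply: val_inj. Qed.

(** The second components of the rows have decreasing degrees. Read from the last
    row backwards they satisfy the same recurrence as the first components, with
    the degrees [beta] instead of [alpha]. *)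
Definition beta m : nat := (e - alpha (K - m))%N.

Definition eucl_row j c : {poly int} :=
  if c == ord0 then continuant alpha j else continuant beta (K.+1 - j).

Definition eucl_system i r : 'I_2 -> {poly int} :=
  eucl_row (if r == ord0 then i.+1 else i).

Definition eucl_orders i c : nat :=
  (if c == ord0 then alpha i else e - alpha i)%N.

Lemma beta_incr m : (m < K)%N -> (beta m < beta m.+1)%N.
Proof.
move=> mK; have lt : (alpha (K - m.+1) < alpha (K - m))%N.
  by rewrite -(subnSK mK); apply: alpha_incr; rewrite ltn_subrL (leq_trans _ mK).
by apply: ltn_sub2l => //; apply: leq_trans lt (alpha_le (leq_subr m K)).
Qed.

(** The recurrence is symmetric under reversal of the sequence of rows, so it holds
    for both components. *)
Lemma eucl_row_rec (V : zmodType) (Z : 'I_2 -> nat -> V) j t : (j < K)%N ->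
  row_act (eucl_row j.+2) Z t =
  row_act (eucl_row j.+1) Z (t + (alpha j.+1 - alpha j)) -
  row_act (eucl_row j) Z t.
Proof.
move=> jK; rewrite /row_act -sumrB; apply: eq_bigr => c _; rewrite /eucl_row.
case: eqP => _; first by rewrite continuantSS shift_actB shift_actXnM.
have [m Em] : exists m, K = (m + j).+1 by exists (K - j.+1)%N; rewrite -addnS subnK.
have -> : (K.+1 - j = m.+2)%N by rewrite Em -!addSn addnK.
have -> : (K.+1 - j.+1 = m.+1)%N by rewrite Em -addSn subSS addnK.
have -> : (K.+1 - j.+2 = m)%N by rewrite Em !subSS addnK.
rewrite continuantSS shift_actB shift_actXnM opprB addrCA.
have -> : (beta m.+1 - beta m = alpha j.+1 - alpha j)%N.
  have aj : (alpha j <= e)%N by rewrite alpha_le // ltnW.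
  rewrite /beta Em subSS addKn -addnS addKn subnBA ?alpha_le //.
  by rewrite addnC addnBA // subnAC addnK.
by rewrite subrr addr0.
Qed.

Lemma eucl_system_solved i : (i <= K)%N ->
  solved_for (eucl_orders i) (eucl_system i).
Proof.
move=> iK; have bi : beta (K - i) = (e - alpha i)%N by rewrite /beta subKn.
rewrite /eucl_system /eucl_row /eucl_orders; split=> [r|r c].
  have [_|r1] := eqVneq r ord0; first exact: (continuant_monic alpha_incr).
  rewrite subSn // -bi; apply: (continuant_monic beta_incr); exact: leq_subr.
have [Er|r1] := eqVneq r ord0; have [Ec|c1] := eqVneq c ord0.
- by rewrite Er Ec eqxx.
- by rewrite subSS -bi => _; apply: (size_continuant beta_incr); apply: leq_subr.
- by move=> _; apply: (size_continuant alpha_incr).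
- by rewrite (ord2_neq0 r1) (ord2_neq0 c1) eqxx.
Qed.

(** [eucl_row_rec] expresses each row through the two rows after it and also
    through the two rows before it, so a common solution of two consecutive rows
    is a solution of all of them. *)
Lemma eucl_system_solution (V : zmodType) (Z : 'I_2 -> nat -> V) i :
  (i <= K)%N ->
  solution (eucl_system i) Z <->
  (forall j t, (j <= K.+1)%N -> row_act (eucl_row j) Z t = 0).
Proof.
move=> iK; split=> [sZ|all0]; last first.
  by move=> r t; rewrite /eucl_system; apply: all0; case: eqP => _ //; apply: leqW.
pose ok j := forall t, row_act (eucl_row j) Z t = 0.
have ok_i : ok i /\ ok i.+1 by split=> t; [apply: (sZ ord_max) | apply: (sZ ord0)].
have up j : (i + j <= K)%N -> ok (i + j)%N /\ ok (i + j).+1.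
  elim: j => [|j IH]; first by rewrite addn0.
  rewrite addnS => jK; have [ok0 ok1] := IH (ltnW jK); split=> // t.
  by rewrite eucl_row_rec // ok0 ok1 subrr.
have down j : (j <= i)%N -> ok (i - j)%N /\ ok (i - j).+1.
  elim: j => [|j IH] ji; first by rewrite subn0.
  have [] := IH (ltnW ji); rewrite -(subnSK ji) => ok0 ok1; split=> // t.
  have jK : (i - j.+1 < K)%N by apply: leq_trans iK; rewrite ltn_subrL (leq_trans _ ji).
  apply/eqP; rewrite -oppr_eq0; apply/eqP.
  by have := eucl_row_rec Z t jK; rewrite ok0 ok1 add0r => <-.
move=> j t jK; have [ji|ij] := leqP j i.
  by rewrite -(subKn ji); have [-> _] := down (i - j)%N (leq_subr _ _).
case: j ij jK => // j ij jK; rewrite ltnS in ij.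
by have := up (j - i)%N; rewrite subnKC // => /(_ jK) [_ ->].
Qed.

(** The leader of row [0] is a derivative of the second unknown and that of row
    [K.+1] a derivative of the first one. At the least [i] such that row [i.+1]
    is led by the first unknown, rows [i.+1] and [i] have their leaders on the
    diagonal of the system. *)
Lemma eucl_system_leads le : ranking le ->
  exists2 i, (i <= K)%N & leads (eucl_orders i) (eucl_system i) le.
Proof.
move=> rk; have [le_total le_trans _ _ _] := rk.
pose first_leads j := (j == K.+1) ||
  ((0 < j)%N && le (ord_max : 'I_2, (e - alpha j)%N) (ord0, alpha j.-1)).
have ex : exists m, first_leads m.+1 by exists K; rewrite /first_leads eqxx.
have [i lead_i min_i] := ex_minnP ex.
have iK : (i <= K)%N by apply: min_i; rewrite /first_leads eqxx.
exists i => // r c k; rewrite /eucl_system /eucl_row /eucl_orders.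
have [-> /[dup] /ord2_neq0 -> _|/ord2_neq0 -> c1] := eqVneq r ord0.
  rewrite subSS /= => lk; have [Ei|ne] := eqVneq i K.
    by rewrite Ei subnn size_poly0 in lk.
  have iK' : (i < K)%N by rewrite ltn_neqAle ne.
  move: lead_i; rewrite /first_leads eqSS (negbTE ne) /=; apply: le_trans.
  apply: ranking_le_order => //; move: lk; rewrite -(subnSK iK').
  have [_ ->] := continuant_monic beta_incr (leq_subr i.+1 K).
  by rewrite /beta subKn.
have -> : c = ord0.
  by apply/eqP; apply: contraNT c1 => /ord2_neq0 ->.
case: i {lead_i} iK min_i => [|i] iK min_i /= lk; first by rewrite size_poly0 in lk.
have {lk} : (k < (alpha i).+1)%N.
  by have [_ <-] := continuant_monic alpha_incr (ltnW iK).
rewrite ltnS => /(ranking_le_order rk ord0) lk; apply: le_trans lk _.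
have := contraNN (min_i i); rewrite ltnn => /(_ isT).
rewrite /first_leads /= negb_or => /andP[_ nle].
by case/orP: (le_total (ord0, alpha i) (ord_max, (e - alpha i.+1)%N)) nle => // ->.
Qed.

Section Ideal.
Variable F : fieldType.

Definition eucl_ideal : dpoly F 2 -> Prop :=
  system_ideal (eucl_orders 0) (eucl_system 0).

Let solved0 : solved_for (eucl_orders 0) (eucl_system 0).
Proof. exact: eucl_system_solved. Qed.

Let same i : (i <= K)%N -> forall Z : 'I_2 -> nat -> dpoly F 2,
  solution (eucl_system 0) Z <-> solution (eucl_system i) Z.
Proof.
move=> iK Z; apply: iff_trans (eucl_system_solution Z (leq0n K)) _.
exact: iff_sym (eucl_system_solution Z iK).
Qed.

Lemma eucl_ideal_row j : (j <= K.+1)%N -> eucl_ideal (row_poly F (eucl_row j)).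
Proof.
move=> jK; apply: row_poly_in_ideal => // Z sZ t.
by apply: (eucl_system_solution Z (leq0n K)).1.
Qed.

(** The last row and row [0] are nonzero elements of the ideal that involve the
    first, respectively the second unknown alone. *)
Lemma eucl_ideal_dim0 : has_diff_dim eucl_ideal 0.
Proof.
split=> [|S indep].
  exists set0; split; last exact: cards0.
  move=> A PA none; apply: (system_ideal_low0 PA) => m v mA vm.
  have : v.1 \in (set0 : {set 'I_2}) by apply: none; apply/occursP; exists m.
  by rewrite in_set0.
rewrite leqn0 cards_eq0; apply/eqP/setP => c; rewrite in_set0.
apply/negP => cS.
have [r [Pr rc]] : exists r : 'I_2 -> {poly int}, eucl_ideal (row_poly F r) /\
    ((exists k, r c \is monic /\ size (r c) = k.+1) /\
     forall c' : 'I_2, c' != c -> r c' = 0).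
  have [->|/ord2_neq0 ->] := eqVneq c ord0.
    exists (eucl_row K.+1); split; first exact: eucl_ideal_row.
    split; first by exists (alpha K); apply: (continuant_monic alpha_incr).
    by move=> j /ord2_neq0 ->; rewrite /eucl_row subnn.
  exists (eucl_row 0); split; first exact: eucl_ideal_row.
  split; first by exists (beta K); apply: (continuant_monic beta_incr).
  move=> j jc; rewrite /eucl_row; case: eqP => // /eqP /ord2_neq0 Ej.
  by rewrite Ej eqxx in jc.
have [[k [mr sr]] r0] := rc.
have : occurs (c, k) (row_poly F r) by apply: occurs_row_poly_monic.
rewrite (indep _ Pr); first by move=> /occursP [m]; rewrite msupp0.
move=> [j l] /occurs_row_poly lj /=; have [-> //|jc] := eqVneq j c.
by rewrite r0 // size_poly0 in lj.
Qed.

Lemma eucl_ideal_orders (o : 2.-tuple nat) :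
  orders eucl_ideal o <->
  exists2 i, (i <= K)%N & o = [tuple alpha i; (e - alpha i)%N].
Proof.
have tupE i : [tuple eucl_orders i c | c < 2] = [tuple alpha i; (e - alpha i)%N].
  by apply: eq_from_tnth => -[[|[|c]] lt] //; rewrite tnth_mktuple.
split=> [[le [s [A [rk cs sA leadA ->]]]]|[i iK ->]].
  have [i iK lead] := eucl_system_leads rk; exists i => //.
  rewrite -tupE; apply: eq_from_tnth => c; rewrite !tnth_mktuple.
  exact: (leads_char_set_orders solved0 (eucl_system_solved iK) (same iK)
            rk lead cs sA leadA).
rewrite -tupE; apply: system_orders => //; [exact: eucl_system_solved | exact: same].
Qed.

End Ideal.
End PrescribedOrders.

Theorem proposition149 (F : fieldType) (d : F -> F) (hd : derivation d)
    (hF : [pchar F] =i pred0) (e : nat) (I : {set 'I_e.+1}) (hI : I != set0) :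
  exists P : dpoly F 2 -> Prop,
    [/\ prime_diff_ideal d P,
        has_diff_dim P 0
      & forall o : 2.-tuple nat,
          orders P o <->
          exists2 a : 'I_e.+1, a \in I & o = [tuple (a : nat); (e - a)%N]].
Proof.
pose s := sort leq [seq val a | a <- enum I].
have mem_s (k : nat) : reflect (exists2 a : 'I_e.+1, a \in I & k = a) (k \in s).
  rewrite mem_sort; apply: (iffP mapP) => [[a]|[a aI ->]].
    by rewrite mem_enum => aI ->; exists a.
  by exists a; rewrite ?mem_enum.
have s_incr : sorted ltn s.
  rewrite ltn_sorted_uniq_leq sort_uniq map_inj_uniq ?enum_uniq; last exact: val_inj.
  exact: (sort_sorted leq_total).
have [K sK] : exists K, size s = K.+1.
  exists (size s).-1; rewrite prednK // size_sort size_map -cardE.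
  by rewrite lt0n cards_eq0.
have incr i : (i < K)%N -> (nth 0 s i < nth 0 s i.+1)%N.
  move=> iK; apply: (sorted_ltn_nth ltn_trans 0 s_incr) => //; rewrite inE sK ltnS //.
  exact: ltnW.
have le_e i : (i <= K)%N -> (nth 0 s i <= e)%N.
  move=> iK; have /mem_s [a _ ->] : nth 0 s i \in s by rewrite mem_nth // sK.
  by rewrite -ltnS.
exists (eucl_ideal (nth 0 s) K e (F := F)); split.
- by apply: system_ideal_prime => //; apply: eucl_system_solved.
- exact: eucl_ideal_dim0.
move=> o; have [ord_o o_ord] := eucl_ideal_orders incr le_e F o.
split=> [/ord_o [i iK ->]|[a aI Eo]].
  have /mem_s [a aI ->] : nth 0 s i \in s by rewrite mem_nth // sK.
  by exists a.
apply: o_ord; have /(nthP 0) [i iK Ei] : val a \in s by apply/mem_s; exists a.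
by exists i; rewrite ?Eo ?Ei // -ltnS -sK.
Qed.
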